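(* Let $r$ be a positive integer and let $D$ be a finite digraph with no $(r-1)$-source sets. Then $D$ contains $r$ pairwise disjoint $2^{r+1}$-kernels.
   Context: For a set $S$ of vertices, $N^-(S)=\{u\in V(D)\setminus S:\ \exists v\in S,\ uv\in E(D)\}$. A set $S\subseteq V(D)$ is a source set if $N^-(S)=\emptyset$; it is an $s$-source set if moreover $S$ is non-empty and $|S|\le s$. A set of vertices is independent if there are no arcs between two of its vertices. $\mathrm{dist}(u,v)$ is the length of a shortest directed path from $u$ to $v$, and $\mathrm{dist}(S,v)=\min_{u\in S}\mathrm{dist}(u,v)$. For an integer $q\ge 1$, a $q$-kernel is an independent set $Q$ with $\mathrm{dist}(Q,v)\le q$ for all $v\in V(D)$. *)

(* Defs.v *)
From mathcomp Require Import all_boot.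
Set Implicit Arguments.
Unset Strict Implicit.
Unset Printing Implicit Defensive.

(* A finite digraph is a finType V of vertices with its arc relation e : rel V;
   e u v means that uv is an arc. Opposite arcs uv, vu are allowed. *)
Section Digraph.
Variables (V : finType) (e : rel V).

Definition in_nbrs (S : {set V}) : {set V} :=
  [set u | (u \notin S) && [exists v in S, e u v]].

Definition source_set (S : {set V}) : bool := in_nbrs S == set0.

Definition s_source_set (s : nat) (S : {set V}) : bool :=
  [&& source_set S, S != set0 & #|S| <= s].

(* "Two vertices" are distinct vertices: a loop, if e has any, does not destroy
   independence, so loops are irrelevant to all the notions defined here. *)
Definition independent (S : {set V}) : bool :=
  [forall u in S, forall v in S, (u != v) ==> ~~ e u v].

(* u :: p is a directed path (no repeated vertex) from u to v, of length size p *)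
Definition dipath (u v : V) (p : seq V) : bool :=
  [&& path e u p, last u p == v & uniq (u :: p)].

Definition dipath_len (u v : V) (n : nat) : bool :=
  [exists p : n.-tuple V, dipath u v p].

(* Distances lie in option nat, with None for infinity (no directed path).
   A directed path has length less than #|V|, so iota 0 #|V| lists, in
   increasing order, all the candidate lengths. *)
Definition dist (u v : V) : option nat :=
  ohead [seq n <- iota 0 #|V| | dipath_len u v n].

(* oAC extends minn to option nat with None as neutral element. *)
Definition dist_set (S : {set V}) (v : V) : option nat :=
  \big[oAC minnA minnC/None]_(u in S) dist u v.

Definition dist_le (d : option nat) (q : nat) : bool :=
  if d is Some n then n <= q else false.

Definition q_kernel (q : nat) (Q : {set V}) : bool :=
  independent Q && [forall v, dist_le (dist_set Q v) q].

End Digraph.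

(* Main.v *)
Require Import Defs.
From mathcomp Require Import all_boot.
From mathcomp Require Import zify.

(** Independence comes for free: a set [X] of vertices contains a 2-kernel [Q]
    of the digraph induced on [X] (Chvatal-Lovasz), so if [X] reaches every
    vertex within [q] steps, then [Q] does so within [q + 2] steps.  Let [s] be
    [r - 1].  It thus suffices to colour the vertices with [s + 1] colours in
    such a way that every vertex is reached from every colour within [4 * s]
    steps.

    Let [R] be an inclusion-minimal set from which all vertices are reachable,
    and call its elements roots.  As there is no [s]-source set, the ball [B x]
    of the vertices from which [x] is reached within [s] steps has more than
    [s] elements.  Colour [v] with its depth, i.e. its distance from [R], modulo
    [s + 1], except that [B x] is recoloured with all the colours whenever [x]
    is a root such that all the depths in [B x] are less than [s].  A vertex of
    depth at least [2 * s] sees all the colours on the last [s + 1] vertices of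
    a shortest path from [R].  Any other vertex is close to a root [x]; either
    [B x] has all the colours, or some [y] in [B x] has depth at least [s], and
    then a shortest path from [R] to [y] has all of them. *)

Set Implicit Arguments.
Unset Strict Implicit.
Unset Printing Implicit Defensive.

Lemma exists_modn_sub m r i :
  r <= m.+1 -> i < r -> exists2 j, j < r & (m - j) %% r = i.
Proof.
move=> le_rm lt_ir; pose j := (m + (r - i)) %% r.
have lt_jr : j < r by rewrite ltn_mod; lia.
exists j => //; rewrite -[RHS](modn_small lt_ir); apply/eqP.
rewrite -(eqn_modDr j) subnK; last by lia.
by rewrite modnDmr addnCA subnKC ?modnDr // ltnW.
Qed.

Lemma dist_le_leq d m n : m <= n -> dist_le d m -> dist_le d n.
Proof. by case: d => //= k le_mn /leq_trans->. Qed.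

Lemma dist_le_min n :
  {morph dist_le^~ n : c d / oAC minnA minnC c d >-> c || d}.
Proof. by move=> [k|] [l|] //=; rewrite ?orbF // geq_min. Qed.

Section Digraph.
Variables (V : finType) (e : rel V).
Implicit Types (u v w x y : V) (Q R S : {set V}).

Lemma independentP S :
  reflect {in S &, forall u v, u != v -> ~~ e u v} (independent e S).
Proof.
apply: (iffP forall_inP) => [indS u v uS vS | indS u uS].
  exact/implyP/(forall_inP (indS u uS)).
by apply/forall_inP=> v vS; apply/implyP/indS.
Qed.

Lemma independentU1 v S :
    independent e S -> {in S, forall u, ~~ e u v && ~~ e v u} ->
  independent e (v |: S).
Proof.
move=> /independentP indS no_arc; apply/independentP=> u w.
case/setU1P=> [-> | uS] /setU1P[-> | wS]; rewrite ?eqxx //.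
- by case/andP: (no_arc w wS).
- by case/andP: (no_arc u uS).
- exact: indS.
Qed.

Definition reach n u v : bool := dist_le (dist e u v) n.

Lemma reachP n u v :
  reflect (exists p, [/\ path e u p, last u p = v & size p <= n]) (reach n u v).
Proof.
rewrite /reach /dist; set lens := [seq _ <- _ | _].
apply: (iffP idP) => [|[p0 [/shortenP[p ep up sub_p] lp le_n]]].
  have : all (dipath_len e u v) lens by exact: filter_all.
  case: lens => //= k s /andP[/existsP[p /and3P[ep /eqP lp _]] _] le_kn.
  by exists p; rewrite size_tuple.
have p_lens : size p \in lens.
  rewrite mem_filter mem_iota /= add0n; apply/andP; split.
    by apply/existsP; exists (in_tuple p); rewrite /dipath ep lp eqxx.
  by rewrite -[_.+1]/(size (u :: p)) -(card_uniqP up) max_card.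
have : sorted leq lens by apply: sorted_filter leq_trans _ _ (iota_sorted _ _).
have {}le_n : size p <= n.
  by apply: leq_trans le_n; apply: uniq_leq_size sub_p; case/andP: up.
case: lens p_lens => //= k s /[!inE] /predU1P[<- //|p_s].
by move/(order_path_min leq_trans)/allP/(_ _ p_s)/leq_trans; apply.
Qed.

Lemma reach_leq m n u v : m <= n -> reach m u v -> reach n u v.
Proof. exact: dist_le_leq. Qed.

Lemma reach_refl n u : reach n u u.
Proof. by apply/reachP; exists [::]. Qed.

Lemma reach_arc u v : e u v -> reach 1 u v.
Proof. by move=> uv; apply/reachP; exists [:: v]; rewrite /= uv. Qed.

Lemma reach_trans m n u v w : reach m u v -> reach n v w -> reach (m + n) u w.
Proof.
case/reachP=> p [ep lp le_m] /reachP[q [vq lq le_n]]; apply/reachP.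
by exists (p ++ q); rewrite cat_path last_cat lp ep size_cat leq_add.
Qed.

Lemma reach_last_arc n u v :
  reach n.+1 u v -> reach n u v \/ exists2 w, reach n u w & e w v.
Proof.
case/reachP=> p []; case/lastP: p => [_ <- _ | p w].
  by left; apply: reach_refl.
rewrite rcons_path last_rcons size_rcons ltnS => /andP[ep ew] <- le_n.
by right; exists (last u p) => //; apply/reachP; exists p.
Qed.

Lemma connect_reachP u v : reflect (exists n, reach n u v) (connect e u v).
Proof.
apply: (iffP connectP) => [[p ep ->] | [n /reachP[p [ep <- _]]]].
  by exists (size p); apply/reachP; exists p.
by exists p.
Qed.

Lemma reach_connect n u v : reach n u v -> connect e u v.
Proof. by move=> uv; apply/connect_reachP; exists n. Qed.

Lemma dist_setP S n v :
  reflect (exists2 u, u \in S & reach n u v) (dist_le (dist_set e S v) n).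
Proof.
have dist_le_None : dist_le None n = false by [].
rewrite /dist_set (big_morph _ (dist_le_min n) dist_le_None).
by rewrite big_orE; apply: exists_inP.
Qed.

Lemma dist_set_trans S m n u v :
  dist_le (dist_set e S u) m -> reach n u v -> dist_le (dist_set e S v) (m + n).
Proof.
case/dist_setP=> w wS wu uv; apply/dist_setP.
by exists w => //; apply: reach_trans uv.
Qed.

Lemma dist_set_pred S v n :
  dist_set e S v = Some n.+1 -> exists2 w, e w v & dist_set e S w = Some n.
Proof.
move=> dv.
have /dist_setP[u uS] : dist_le (dist_set e S v) n.+1 by rewrite dv /=.
case/reach_last_arc=> [uv | [w uw wv]].
  have /dist_setP : exists2 u, u \in S & reach n u v by exists u.
  by rewrite dv /= ltnn.
exists w => //; have : dist_le (dist_set e S w) n by apply/dist_setP; exists u.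
case dw: (dist_set e S w) => [k|] //= le_kn.
have : dist_le (dist_set e S v) (k + 1).
  by apply: dist_set_trans (reach_arc wv); rewrite dw /=.
rewrite dv /= addn1 ltnS => le_nk.
by congr Some; apply/eqP; rewrite eqn_leq le_kn.
Qed.

Lemma dist_set_ancestor S v j n :
    dist_set e S v = Some (j + n) ->
  exists2 w, reach j w v & dist_set e S w = Some n.
Proof.
elim: j v => [|j IHj] v; first by exists v; first exact: reach_refl.
case/dist_set_pred=> u uv /IHj[w wu dw].
by exists w => //; rewrite -addn1; apply: reach_trans wu (reach_arc uv).
Qed.

Lemma quasi_kernel_sub S :
  exists Q : {set V}, [/\ Q \subset S, independent e Q &
    {in S, forall v, exists2 u, u \in Q & reach 2 u v}].
Proof.
have [n] := ubnP #|S|; elim: n S => // n IHn S; rewrite ltnS => leSn.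
have [-> | [v vS]] := set_0Vmem S.
  exists set0; split; [exact: sub0set | | by move=> v; rewrite inE].
  by apply/independentP=> u; rewrite inE.
(* A 2-kernel [Q] of what remains after deleting [v] and its out-neighbours
   either has an arc to [v], or stays independent once [v] is added. *)
pose S' := [set u in S | (u != v) && ~~ e v u].
have S'S : S' \subset S by apply/subsetP=> u; rewrite inE => /andP[].
have [|Q [QS' indQ domQ]] := IHn S'.
  apply: leq_trans leSn; apply: proper_card; rewrite properE S'S /=.
  by apply/subsetPn; exists v; rewrite // inE eqxx andbF.
have reach_v u : u \in S -> u \notin S' -> reach 1 v u.
  move=> uS; rewrite inE uS andTb negb_and !negbK => /orP[/eqP->|/reach_arc //].
  exact: reach_refl.
have [/exists_inP[q qQ qv] | /exists_inPn noQv] := boolP [exists q in Q, e q v].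
  exists Q; split=> // [|u uS]; first exact: subset_trans S'S.
  have [/domQ // | /(reach_v _ uS) vu] := boolP (u \in S').
  by exists q => //; apply: reach_trans (reach_arc qv) vu.
exists (v |: Q); split=> [||u uS].
- by rewrite subUset sub1set vS (subset_trans QS' S'S).
- apply: independentU1 => // u uQ; rewrite noQv //.
  by move/(subsetP QS'): uQ; rewrite inE => /and3P[].
- have [/domQ[q qQ qu] | /(reach_v _ uS) vu] := boolP (u \in S').
    by exists q => //; apply: setU1r.
  by exists v; [apply: setU11 | apply: reach_leq vu].
Qed.

Lemma q_kernel_leq m n Q : m <= n -> q_kernel e m Q -> q_kernel e n Q.
Proof.
move=> le_mn /andP[indQ /forallP domQ]; rewrite /q_kernel indQ.
by apply/forallP=> v; apply: dist_le_leq (domQ v).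
Qed.

Lemma q_kernel_sub q S :
    (forall v, exists2 u, u \in S & reach q u v) ->
  exists2 Q : {set V}, Q \subset S & q_kernel e (q + 2) Q.
Proof.
move=> domS; have [Q [QS indQ domQ]] := quasi_kernel_sub S.
exists Q; rewrite // /q_kernel indQ; apply/forallP=> v; rewrite addnC.
have [u /domQ[w wQ wu] uv] := domS v.
by apply: dist_set_trans uv; apply/dist_setP; exists w.
Qed.

Lemma disjoint_kernels_of_colouring (I : finType) (c : V -> I) q :
    (forall v i, exists2 u, c u = i & reach q u v) ->
  exists Q : I -> {set V}, (forall i, q_kernel e (q + 2) (Q i)) /\
    (forall i j, i != j -> [disjoint Q i & Q j]).
Proof.
move=> near_c.
have kernel_in i :
    exists2 Q : {set V}, Q \subset c @^-1: [set i] & q_kernel e (q + 2) Q.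
  apply: q_kernel_sub => v; have [u cu uv] := near_c v i.
  by exists u; rewrite // !inE cu.
have [Q Qc kerQ] := fin_all_exists2 kernel_in; exists Q; split=> // i j neq_ij.
rewrite disjoint_subset; apply/subsetP=> v /(subsetP (Qc i)); rewrite !inE.
move=> /eqP cv; apply: contra neq_ij => /(subsetP (Qc j)).
by rewrite !inE cv.
Qed.

Definition spanning S : bool := [forall v, exists u in S, connect e u v].

Lemma exists_minset_spanning : exists R, minset spanning R.
Proof.
have [|R minR] := @ex_minset _ spanning; last by exists R.
by exists setT; apply/forallP=> v; apply/exists_inP; exists v; rewrite ?inE.
Qed.

Lemma minset_spanning_connect R :
  minset spanning R -> {in R &, forall x y, connect e x y -> x = y}.
Proof.
case/minsetP=> /forallP spanR minR x y xR yR xy; apply/eqP/negPn/negP=> neq_xy.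
have /minR : spanning (R :\ y).
  apply/forallP=> v; have /exists_inP[z zR zv] := spanR v; apply/exists_inP.
  have [eq_zy | neq_zy] := eqVneq z y; last by exists z; rewrite // !inE neq_zy.
  by exists x; rewrite ?inE ?neq_xy // (connect_trans xy) // -eq_zy.
by rewrite subsetDl => /(_ isT)/setP/(_ y); rewrite !inE eqxx yR.
Qed.

Lemma minset_spanning_unique R w x y :
    minset spanning R -> x \in R -> y \in R ->
  connect e w x -> connect e w y -> x = y.
Proof.
move=> minR xR yR wx wy; have eq_connect := minset_spanning_connect minR.
have /forallP/(_ w)/exists_inP[z zR zw] := minsetp minR.
rewrite -(eq_connect z x) ?(connect_trans zw wx) //.
by rewrite (eq_connect z y) ?(connect_trans zw wy).
Qed.

Definition in_ball n x : {set V} := [set u | reach n u x].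

Lemma in_nbrs_in_ball n x : in_nbrs e (in_ball n x) \subset in_ball n.+1 x.
Proof.
apply/subsetP=> u; rewrite inE => /andP[_ /exists_inP[v]].
by rewrite !inE => vx uv; apply: reach_trans (reach_arc uv) vx.
Qed.

Lemma ltn_card_in_ball s n x :
    (forall S, ~~ s_source_set e s S) -> n <= s ->
  n < #|in_ball n x|.
Proof.
move=> no_source; elim: n => [|n IHn] lt_ns.
  by apply/card_gt0P; exists x; rewrite inE reach_refl.
have sub : in_ball n x \subset in_ball n.+1 x.
  by apply/subsetP=> u; rewrite !inE; apply: reach_leq.
have [le_s | lt_s] := leqP #|in_ball n x| s; last first.
  by apply: leq_trans (subset_leq_card sub); apply: leq_ltn_trans lt_s.
have /set0Pn[u u_nbr] : in_nbrs e (in_ball n x) != set0.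
  apply: contra (no_source (in_ball n x)) => src; rewrite /s_source_set le_s.
  rewrite /source_set src andbT; apply/set0Pn.
  by exists x; rewrite inE reach_refl.
apply: leq_ltn_trans (IHn (ltnW lt_ns)) (proper_card _).
rewrite properE sub; apply/subsetPn; exists u.
  exact: (subsetP (in_nbrs_in_ball n x)).
by move: u_nbr; rewrite inE => /andP[].
Qed.

End Digraph.

Section Colouring.
Variables (V : finType) (e : rel V) (s : nat) (R : {set V}).
Hypothesis no_source : forall S : {set V}, ~~ s_source_set e s S.
Hypothesis minR : minset (spanning e) R.
Implicit Types (u v w x y : V) (i : 'I_s.+1).

(* The default value is never taken, as [R] is spanning. *)
Definition depth v : nat := odflt 0 (dist_set e R v).

Lemma dist_set_depth v : dist_set e R v = Some (depth v).
Proof.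
have /forallP/(_ v)/exists_inP[x xR /connect_reachP[n xv]] := minsetp minR.
have : dist_le (dist_set e R v) n by apply/dist_setP; exists x.
by rewrite /depth; case: (dist_set e R v).
Qed.

Lemma depth_reach v : exists2 x, x \in R & reach e (depth v) x v.
Proof. by apply/dist_setP; rewrite dist_set_depth /=. Qed.

Lemma depth_ancestor_modn v i : s <= depth v ->
  exists w, [/\ reach e s w v, depth w %% s.+1 = i & depth v <= depth w + s].
Proof.
move=> le_sv.
have [//|j lt_js eq_i] := @exists_modn_sub (depth v) s.+1 i _ (ltn_ord i).
have le_jv : j <= depth v by apply: leq_trans le_sv.
have [|w wv] := @dist_set_ancestor _ e R v j (depth v - j).
  by rewrite dist_set_depth subnKC.
rewrite dist_set_depth => -[dw]; exists w; split; rewrite ?dw //; last by lia.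
exact: reach_leq wv.
Qed.

Definition shallow_root x : bool :=
  (x \in R) && [forall y in in_ball e s x, depth y < s].

(* The indices greater than [s] are sent to 0 by [inord]. *)
Definition colour v : 'I_s.+1 :=
  inord (if [pick x | shallow_root x & v \in in_ball e s x] is Some x
         then index v (enum (in_ball e s x)) else depth v %% s.+1).

Lemma colour_shallow x v : shallow_root x -> v \in in_ball e s x ->
  colour v = inord (index v (enum (in_ball e s x))).
Proof.
move=> shx vx; rewrite /colour; case: pickP => [y /andP[] | /(_ x)]; last first.
  by rewrite shx vx.
case/andP=> yR _ vy; have /andP[xR _] := shx; move: (vx) (vy); rewrite !inE.
move=> /reach_connect v_x /reach_connect v_y.
by rewrite (minset_spanning_unique minR yR xR v_y v_x).
Qed.

Lemma colour_depth v : (forall x, shallow_root x -> v \notin in_ball e s x) ->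
  colour v = inord (depth v %% s.+1).
Proof.
move=> notB; rewrite /colour.
by case: pickP => // x /andP[/notB/negPf->].
Qed.

Lemma colour_near_of_depth v i :
    s <= depth v ->
    (forall w x, reach e s w v -> depth v <= depth w + s -> shallow_root x ->
      w \notin in_ball e s x) ->
  exists2 u, colour u = i & reach e s u v.
Proof.
move=> /(depth_ancestor_modn i)[w [wv dw le_vw]] notB.
by exists w => //; rewrite colour_depth ?dw ?inord_val // => x; apply: notB.
Qed.

Lemma colour_near_deep v i :
  2 * s <= depth v -> exists2 u, colour u = i & reach e s u v.
Proof.
move=> le_v; apply: colour_near_of_depth => [|w x _ le_vw]; first by lia.
by case/andP=> _ /forall_inP lt_s; apply/negP=> /lt_s; lia.
Qed.

Lemma colour_near_shallow_root x i :
  shallow_root x -> exists2 u, colour u = i & reach e s u x.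
Proof.
move=> shx; have lt_i : i < #|in_ball e s x|.
  exact: leq_ltn_trans (leq_ord i) (ltn_card_in_ball _ no_source (leqnn s)).
pose u := nth x (enum (in_ball e s x)) i.
have ux : u \in in_ball e s x by rewrite -mem_enum mem_nth -?cardE.
exists u; last by rewrite inE in ux.
by rewrite (colour_shallow shx ux) index_uniq ?enum_uniq -?cardE // inord_val.
Qed.

Lemma colour_near_root x i :
  x \in R -> exists2 u, colour u = i & reach e (2 * s) u x.
Proof.
move=> xR; have [shx | nshx] := boolP (shallow_root x).
  have [u cu ux] := colour_near_shallow_root i shx.
  by exists u => //; apply: reach_leq ux; lia.
move: (nshx); rewrite /shallow_root xR => /forall_inPn[y].
rewrite inE -leqNgt => yx le_sy.
have [w z wy _ shz | u cu uy] := @colour_near_of_depth y i le_sy; last first.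
  by exists u => //; rewrite mul2n -addnn; apply: reach_trans yx.
apply: contra nshx; rewrite inE => /reach_connect wz; have /andP[zR _] := shz.
have wx := reach_connect (reach_trans wy yx).
by rewrite (minset_spanning_unique minR xR zR wx wz).
Qed.

Lemma colour_near v i : exists2 u, colour u = i & reach e (4 * s) u v.
Proof.
have [/(colour_near_deep i)[u cu uv] | lt_v] := leqP (2 * s) (depth v).
  by exists u => //; apply: reach_leq uv; lia.
have [x xR xv] := depth_reach v; have [u cu ux] := colour_near_root i xR.
by exists u => //; apply: reach_leq (reach_trans ux xv); lia.
Qed.

End Colouring.

Lemma disjoint_kernels_of_no_source (V : finType) (e : rel V) s :
    (forall S : {set V}, ~~ s_source_set e s S) ->
  exists Q : 'I_s.+1 -> {set V}, (forall i, q_kernel e (4 * s + 2) (Q i)) /\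
    (forall i j, i != j -> [disjoint Q i & Q j]).
Proof.
move=> no_source; have [R minR] := exists_minset_spanning e.
exact: disjoint_kernels_of_colouring (colour_near no_source minR).
Qed.

Theorem theorem2p4 (V : finType) (e : rel V) (r : nat) (r_gt0 : 0 < r)
    (no_source : forall S : {set V}, ~~ s_source_set e (r - 1) S) :
  exists Q : 'I_r -> {set V},
    (forall i : 'I_r, q_kernel e (2 ^ (r + 1)) (Q i)) /\
    (forall i j : 'I_r, i != j -> [disjoint Q i & Q j]).
Proof.
case: r r_gt0 no_source => // s _; rewrite subn1 /= => no_source.
have [Q [kerQ disjQ]] := disjoint_kernels_of_no_source no_source.
exists Q; split=> // i; apply: q_kernel_leq (kerQ i).
by rewrite addn1 !expnS; have := ltn_expl s (isT : 1 < 2); lia.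
Qed.
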